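(* Let $n\ge 1$ and let $\alpha_1\leq \alpha_2\leq \cdots\leq \alpha_n$ be real numbers with $\sum_{j=1}^n\alpha_j=0$. If $$\phi=\sum_{i=1}^m c_i\phi_i,\qquad c_i\geq 0,\qquad \phi_i\in \mathscr S\quad (i=1,2,\ldots,m),$$ then $$\sum_{j=1}^n\phi(j\alpha_j)\geq 0.$$ In particular, the same conclusion holds for every $\phi\in\mathscr S$.
   Context: $\mathscr S$ denotes the set of all functions $\phi:\mathbb R\to\mathbb R$ such that (1) $\phi$ is odd, and (2) $\phi$ is increasing and convex on $[0,\infty)$. ''Increasing'' is meant in the non-strict sense ($x\le y$ implies $\phi(x)\le\phi(y)$). *)

(* Defs.v *)
From HB Require Import structures.
From mathcomp Require Import all_boot all_order all_algebra.
From mathcomp Require Import boolp classical_sets set_interval reals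
  interval_inference topology convex.

Set Implicit Arguments.
Unset Strict Implicit.
Unset Printing Implicit Defensive.

Import Order.TTheory GRing.Theory Num.Theory.

Local Open Scope classical_set_scope.
Local Open Scope ring_scope.

(* "Increasing" is non-strict. [convex_function] is the library's convexity,
   stated with [x <| t |> y = t * x + (1 - t) * y] for [0 <= t <= 1]; on the
   line it applies to [R^o], i.e. [R] seen as a module over itself. *)
Definition odd_incr_convex (R : realType) : set (R -> R) :=
  [set phi : R -> R |
    [/\ forall x : R, phi (- x) = - phi x,
        {in `[0, +oo[%classic &, {homo phi : x y / x <= y}} &
        @convex_function R R^o `[0, +oo[%classic phi]].

(* Main.v *)
(** Let [k] be the number of negative [alpha_j], put [m = n - k], and let [S] be
    the common value of the sum of the positive terms and of the sum of the
    [- alpha_j] over the negative ones.  For [j <= k] monotonicity gives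
    [j * - alpha_j <= - alpha_1 - ... - alpha_j <= S], so the negative terms
    contribute at least [- k * phi S].  The [l = min (m, k + 1)] largest terms
    have sum at least [l * S / m] and indices at least [n - l + 1], so the sum
    of their [j * alpha_j] is at least [(n - l + 1) * l * S / m = (k + 1) * S];
    since [l <= k + 1] and [phi 0 = 0], Jensen's inequality bounds their
    contribution from below by [(k + 1) * phi S]. *)
Require Import Defs.
From HB Require Import structures.
From mathcomp Require Import all_boot all_order all_algebra.
From mathcomp Require Import boolp classical_sets set_interval reals
  interval_inference topology convex.
From mathcomp Require Import zify ring lra.

Set Implicit Arguments.
Unset Strict Implicit.
Unset Printing Implicit Defensive.

Import Order.TTheory GRing.Theory Num.Theory.

Local Open Scope ring_scope.

Section OddIncrConvex.

Variables (R : realType) (phi : R -> R).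
Hypothesis phiS : odd_incr_convex phi.

Lemma odd_incr_convexN x : phi (- x) = - phi x.
Proof. by case: phiS. Qed.

Lemma odd_incr_convex0 : phi 0 = 0.
Proof. by have := odd_incr_convexN 0; rewrite oppr0; lra. Qed.

Lemma odd_incr_convex_le x y : 0 <= x -> x <= y -> phi x <= phi y.
Proof.
case: phiS => _ phi_homo _ x0 xy.
by apply: phi_homo; rewrite // inE /= in_itv /= andbT // (le_trans x0).
Qed.

Lemma odd_incr_convex_ge0 x : 0 <= x -> 0 <= phi x.
Proof. by move=> x0; rewrite -odd_incr_convex0 odd_incr_convex_le. Qed.

Lemma odd_incr_convex_conv x y t : 0 <= x -> 0 <= y -> 0 <= t <= 1 ->
  phi (t * x + (1 - t) * y) <= t * phi x + (1 - t) * phi y.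
Proof.
case: phiS => _ _ phi_conv x0 y0 /andP[t0 t1].
have := phi_conv (Itv01 t0 t1) x y; rewrite !inE /= !in_itv /= !andbT.
by move=> /(_ x0 y0); rewrite !convRE.
Qed.

(** Equal weights [t] may have total mass below 1: the missing mass sits at 0, where [phi] vanishes.
    By induction, the head keeps weight [t] and the tail is rescaled by [1 / (1 - t)]. *)
Lemma odd_incr_convex_jensen (I : eqType) (r : seq I) (f : I -> R) t :
  {in r, forall i, 0 <= f i} -> 0 <= t -> (size r)%:R * t <= 1 ->
  phi (t * \sum_(i <- r) f i) <= t * \sum_(i <- r) phi (f i).
Proof.
elim: r t => [|i r IHr] t f0 t0 /= rt1.
  by rewrite !big_nil !mulr0 odd_incr_convex0.
rewrite !big_cons !mulrDr.
have fr0 : {in r, forall j, 0 <= f j} by move=> j jr; rewrite f0 // inE jr orbT.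
have fi0 : 0 <= f i by rewrite f0 // mem_head.
have sum0 : 0 <= \sum_(j <- r) f j.
  by rewrite big_seq; apply: sumr_ge0.
have tS : t + (size r)%:R * t <= 1.
  by rewrite -[t in t + _]mul1r -mulrDl -natr1 addrC in rt1 *.
have rt0 : 0 <= (size r)%:R * t by rewrite mulr_ge0.
(* The rescaling needs [1 - t] nonzero; when [t = 1] the mass bound forces the tail to be empty. *)
have [t1|t1] := eqVneq t 1.
  have : (size r <= 0)%N by rewrite -(ler_nat R); move: tS; rewrite t1; lra.
  rewrite leqn0 => /nilP ->; rewrite !big_nil !mulr0 !addr0 t1 !mul1r; lra.
have t1' : 0 < 1 - t by rewrite subr_gt0 lt_neqAle t1; lra.
have u0 : 0 <= t / (1 - t) by rewrite divr_ge0 // ltW.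
have := IHr _ fr0 u0; rewrite mulrA ler_pdivrMr // mul1r lerBrDl => /(_ tS) IH.
have tE s : (1 - t) * (t / (1 - t) * s) = t * s by field; rewrite gt_eqF.
rewrite -(tE (\sum_(j <- r) f j)) -(tE (\sum_(j <- r) phi (f j))).
apply: le_trans (odd_incr_convex_conv _ _ _) _ => //.
- exact: mulr_ge0.
- by rewrite t0; lra.
- by rewrite lerD2l ler_pM2l.
Qed.

Lemma odd_incr_convex_sum_ge (I : eqType) (r : seq I) (f : I -> R) k S :
  {in r, forall i, 0 <= f i} -> (size r <= k.+1)%N -> 0 <= S ->
  k.+1%:R * S <= \sum_(i <- r) f i ->
  k.+1%:R * phi S <= \sum_(i <- r) phi (f i).
Proof.
move=> f0 rk S0 kS; have k0 : 0 < k.+1%:R :> R by rewrite ltr0n.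
rewrite mulrC -ler_pdivlMr // [leRHS]mulrC.
apply: le_trans (odd_incr_convex_jensen f0 _ _); last 2 first.
- by rewrite invr_ge0 ltW.
- by rewrite ler_pdivrMr // mul1r ler_nat.
by apply: odd_incr_convex_le => //; rewrite mulrC ler_pdivlMr // mulrC.
Qed.

End OddIncrConvex.

(** The mean over a final segment is at least the mean over the whole range, with denominators
    cleared: [a p] bounds the head terms from above and the tail terms from below. *)
Lemma nondecreasing_tail_sum (R : realType) (a : nat -> R) (k p n : nat) :
  {homo a : i j / (i <= j)%N >-> i <= j} -> (k <= p)%N -> (p <= n)%N ->
  (n - p)%:R * \sum_(k <= i < n) a i <= (n - k)%:R * \sum_(p <= i < n) a i.
Proof.
move=> a_homo kp pn; rewrite (big_cat_nat kp pn) /=.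
have le_head : \sum_(k <= i < p) a i <= (p - k)%:R * a p.
  rewrite mulr_natl -sumr_const_nat; apply: ler_sum_nat => i /andP[_ ip].
  exact/a_homo/ltnW.
have le_tail : (n - p)%:R * a p <= \sum_(p <= i < n) a i.
  by rewrite mulr_natl -sumr_const_nat; apply: ler_sum_nat => i /andP[/a_homo].
have -> : (n - k)%:R = (n - p)%:R + (p - k)%:R :> R.
  by rewrite -natrD; congr _%:R; lia.
rewrite mulrDr mulrDl addrC lerD2l.
apply: le_trans (ler_wpM2l (ler0n _ _) le_head) _.
by rewrite mulrCA ler_wpM2l.
Qed.

Lemma nondecreasing_sum_ge0 (R : realType) (phi : R -> R) (a : nat -> R)
    (n : nat) :
  odd_incr_convex phi -> {homo a : i j / (i <= j)%N >-> i <= j} ->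
  \sum_(0 <= i < n) a i = 0 -> 0 <= \sum_(0 <= i < n) phi (i.+1%:R * a i).
Proof.
move=> phiS a_homo; case: n => [|n] sum0; first by rewrite big_geq.
(* The largest of the [n.+1] terms is at least their mean, which is 0. *)
have an0 : 0 <= a n.
  rewrite -(pmulrn_lge0 _ (ltn0Sn n)) -sum0 -[X in _ *+ X]subn0 -sumr_const_nat.
  by apply: ler_sum_nat => i /andP[_]; rewrite ltnS => /a_homo.
(* Indices start at 0, so the least index of a nonnegative term is also the number of negative
   terms. *)
case: (ex_minnP (ex_intro (fun i => 0 <= a i) n an0)) => k ak0 k_min.
have kn : (k <= n)%N := k_min n an0.
have a_ge0 i : (k <= i)%N -> 0 <= a i by move=> /a_homo; apply: le_trans.
have a_le0 i : (i < k)%N -> a i <= 0.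
  by move=> ik; rewrite ltW // ltNge; apply/negP => /k_min; rewrite leqNgt ik.
have term_ge0 i : (k <= i)%N -> 0 <= i.+1%:R * a i.
  by move=> /a_ge0; exact: mulr_ge0.
set S := \sum_(k <= i < n.+1) a i.
have S0 : 0 <= S by rewrite /S big_nat; apply: sumr_ge0 => i /andP[/a_ge0].
have negS : \sum_(0 <= i < k) - a i = S.
  move: sum0; rewrite (@big_cat_nat _ _ _ k) //= ?(leqW kn) // sumrN -/S.
  by lra.
have neg_le j : (j < k)%N -> j.+1%:R * - a j <= S.
  move=> jk; rewrite -negS (@big_cat_nat _ _ _ j.+1) //=.
  rewrite mulr_natl -[X in _ *+ X]subn0 -sumr_const_nat -[leLHS]addr0.
  apply: lerD.
    by apply: ler_sum_nat => i /andP[_ ij]; rewrite lerN2 a_homo.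
  by rewrite big_nat; apply: sumr_ge0 => i /andP[_ /a_le0]; rewrite oppr_ge0.
have neg_part : - (k%:R * phi S) <= \sum_(0 <= i < k) phi (i.+1%:R * a i).
  rewrite lerNl -sumrN mulr_natl -[X in _ *+ X]subn0 -sumr_const_nat.
  apply: ler_sum_nat => i /andP[_ ik]; rewrite -odd_incr_convexN // -mulrN.
  apply: odd_incr_convex_le => //; last exact: neg_le.
  by rewrite mulr_ge0 // oppr_ge0 a_le0.
set l := minn (n.+1 - k) k.+1; set p := (n.+1 - l)%N.
have kp : (k <= p)%N by rewrite /p /l; lia.
have pn : (p <= n.+1)%N by rewrite /p; lia.
have top_sum : k.+1%:R * S <= \sum_(p <= i < n.+1) i.+1%:R * a i.
  apply: (@le_trans _ _ (p.+1%:R * \sum_(p <= i < n.+1) a i)); last first.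
    rewrite mulr_sumr; apply: ler_sum_nat => i /andP[pi _].
    by rewrite ler_wpM2r ?a_ge0 ?ler_nat // (leq_trans kp).
  have m0 : 0 < (n.+1 - k)%:R :> R by rewrite ltr0n; lia.
  rewrite -(ler_pM2l m0) mulrA [leRHS]mulrCA -natrM.
  (* Both values of the minimum [l] give the same product: either [p = k], or [p.+1 = n.+1 - k] and
     [n.+1 - p = k.+1]. *)
  have -> : ((n.+1 - k) * k.+1 = p.+1 * (n.+1 - p))%N.
    rewrite /p /l; case: (leqP (n.+1 - k) k.+1) => h.
      by rewrite mulnC; congr (_ * _)%N; lia.
    by congr (_ * _)%N; lia.
  rewrite natrM -mulrA ler_wpM2l //.
  exact: nondecreasing_tail_sum.
have top_part : k.+1%:R * phi S <= \sum_(p <= i < n.+1) phi (i.+1%:R * a i).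
  apply: odd_incr_convex_sum_ge => //.
    by move=> i; rewrite mem_index_iota => /andP[/(leq_trans kp)/term_ge0].
  by rewrite size_iota /p /l; lia.
have mid_part : 0 <= \sum_(k <= i < p) phi (i.+1%:R * a i).
  rewrite big_nat; apply: sumr_ge0 => i /andP[ki _].
  exact/odd_incr_convex_ge0/term_ge0.
have phiS0 : 0 <= phi S by apply: odd_incr_convex_ge0.
(* The top part supplies [k.+1] copies of [phi S] against the [k] lost in the negative part, and
   [phi S] is nonnegative. *)
rewrite (big_cat_nat (leq0n k) (leqW kn)) /= (big_cat_nat kp pn) /=.
by rewrite -natr1 mulrDl mul1r in top_part; lra.
Qed.

Theorem theorem2 (R : realType) (n : nat) (hn : (1 <= n)%N)
    (alpha : 'I_n -> R)
    (halpha : forall i j : 'I_n, (i <= j)%N -> alpha i <= alpha j)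
    (hsum : \sum_(j < n) alpha j = 0) :
  (forall (m : nat) (c : 'I_m -> R) (phis : 'I_m -> R -> R) (phi : R -> R),
      (forall i : 'I_m, 0 <= c i) ->
      (forall i : 'I_m, odd_incr_convex (phis i)) ->
      (forall x : R, phi x = \sum_(i < m) c i * phis i x) ->
      0 <= \sum_(j < n) phi (j.+1%:R * alpha j)) /\
  (forall phi : R -> R, odd_incr_convex phi ->
      0 <= \sum_(j < n) phi (j.+1%:R * alpha j)).
Proof.
have single phi : odd_incr_convex phi ->
    0 <= \sum_(j < n) phi (j.+1%:R * alpha j).
  case: n hn alpha halpha hsum => // n _ alpha alpha_le sum0 phiS.
  (* Repeating the last value beyond index [n] keeps the sequence nondecreasing on all of [nat]. *)
  pose a i := alpha (inord (minn i n)).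
  have aE (i : 'I_n.+1) : a i = alpha i.
    by rewrite /a (minn_idPl _) ?inord_val // -ltnS.
  have a_homo : {homo a : i j / (i <= j)%N >-> i <= j}.
    by move=> i j ij; apply: alpha_le; rewrite !inordK; lia.
  under eq_bigr do rewrite -aE.
  rewrite -(big_mkord xpredT (fun i => phi (i.+1%:R * a i))).
  apply: nondecreasing_sum_ge0 => //.
  by rewrite big_mkord -[RHS]sum0; apply: eq_bigr => i _; rewrite aE.
split=> // m c phis phi c0 phisS phiE.
under eq_bigr do rewrite phiE.
(* The conclusion is linear in [phi], so the case of a single function applies to each [phis i]. *)
rewrite exchange_big /=; apply: sumr_ge0 => i _.
by rewrite -mulr_sumr mulr_ge0 // single.
Qed.
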